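(* Let $A$ be an idempotent semiring. Let $\mathrm{Spv}\,A$ (resp. $\mathrm{Spec}_{\mathfrak c}A$) be the space of valuations (resp. the space of prime congruences) on $A$. Then there is a natural bijection of sets between $\mathrm{Spv}\,A$ and $\mathrm{Spec}_{\mathfrak c}A$. Furthermore, $\mathrm{Spv}\,A$ and $\mathrm{Spec}_{\mathfrak c}A$ are spectral spaces.
   Context: A semiring is a nonempty set $A$ with operations $+,\cdot$ such that $(A,+)$ and $(A,\cdot)$ are commutative monoids (with identities $0$ and $1$), $(a+b)c=ac+bc$ and $0\cdot a=0$ for all $a,b,c\in A$; it is idempotent if $a+a=a$ for all $a\in A$. For a totally ordered abelian group $(\Gamma,+_\Gamma)$, $\Gamma_{\max}$ is the semifield with underlying set $\Gamma\cup\{-\infty\}$, with addition $\max$ (with $-\infty$ the least element) and multiplication $+_\Gamma$ (with $-\infty$ absorbing); its additive identity $-\infty$ is written $0$ and its multiplicative identity is written $1$. A valuation on an idempotent semiring $A$ is a function $\nu:A\to\Gamma_{\max}$, for some totally ordered abelian group $\Gamma$, with $\nu(0)=0$, $\nu(1)=1$, $\nu(xy)=\nu(x)\nu(y)$ and $\nu(x+y)=\nu(x)+\nu(y)=\max\{\nu(x),\nu(y)\}$ for all $x,y\in A$. Two valuations $\nu_1,\nu_2$ on $A$ are equivalent if there is a semiring isomorphism $f:\nu_1(A)\to\nu_2(A)$ with $f\circ\nu_1=\nu_2$. The space of valuations $\mathrm{Spv}\,A$ is the set of equivalence classes $[\nu]$ of valuations on $A$, with the topology having as a basis of open sets the sets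 $D(x,y)=\{[\nu]\in\mathrm{Spv}\,A\mid \nu(x)\le\nu(y),\ \nu(y)\ne0\}$, $(x,y)\in A\times A$. A congruence on $A$ is an equivalence relation $C\subseteq A\times A$ that is also a subsemiring of $A\times A$. The twisted product of $x=(x_1,x_2)$, $y=(y_1,y_2)\in A\times A$ is $x\cdot_t y=(x_1y_1+x_2y_2,\;x_1y_2+x_2y_1)$. A congruence $C$ is prime if $C\ne A\times A$ and $x\cdot_t y\in C$ implies $x\in C$ or $y\in C$, for all $x,y\in A\times A$. The space of prime congruences $\mathrm{Spec}_{\mathfrak c}A$ is the set of prime congruences on $A$ with the subspace topology from the hull-kernel topology on $2^{A\times A}$, whose open sub-basis consists of the sets $D(F)=\{I\in 2^{A\times A}\mid F\not\subseteq I\}$ with $F\subseteq A\times A$ finite. A spectral space is a quasi-compact $T_0$ topological space in which finite intersections of quasi-compact open subsets are quasi-compact open, the quasi-compact open subsets form a basis, and every nonempty irreducible closed subset has a unique generic point. *)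

(* Defs.v *)
From HB Require Import structures.
From mathcomp Require Import all_boot all_order all_algebra.
From mathcomp Require Import all_classical all_reals all_analysis.

Set Implicit Arguments.
Unset Strict Implicit.
Unset Printing Implicit Defensive.

Import Order.TTheory GRing.Theory.

Local Open Scope classical_set_scope.
Local Open Scope ring_scope.

(* Semirings are commutative and may be trivial (1 = 0).
   The structures idemSemiRingType and oagType carry their own universe
   levels: this is what allows Spv A, whose elements are classes of valuations
   into arbitrary ordered groups, to be a topologicalType. *)
HB.mixin Record isAddIdempotent A of GRing.ComPzSemiRing A := {
  add_idem : idempotent_op (@GRing.add A)
}.

#[short(type="idemSemiRingType")]
HB.structure Definition IdemSemiRing :=
  { A of GRing.ComPzSemiRing A & isAddIdempotent A }.

HB.mixin Record isTotallyOrderedZmodule G of Num.POrderedZmodule G := {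
  oag_le_total : total (<=%O : rel G);
  oag_leD2l : forall z x y : G, x <= y -> z + x <= z + y
}.

#[short(type="oagType")]
HB.structure Definition OrderedAbelianGroup :=
  { G of Num.POrderedZmodule G & isTotallyOrderedZmodule G }.

(* Gamma_max; None is -oo. Its addition is Order.max and its multiplication is
   the group law, so its 0 is None and its 1 is Some 0. *)
Definition gmax (G : oagType) : Type := option G.

Section GmaxTheory.
Variable G : oagType.
Implicit Types x y z : gmax G.

HB.instance Definition _ := Choice.on (gmax G).

Definition gmax_le x y : bool :=
  match x, y with
  | None, _ => true
  | Some _, None => false
  | Some a, Some b => a <= b
  end.

Definition gmax_mul x y : gmax G :=
  match x, y with
  | Some a, Some b => Some (a + b)
  | _, _ => None
  end.

Lemma gmax_le_refl : reflexive gmax_le.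
Proof. by case=> //=. Qed.

Lemma gmax_le_anti : antisymmetric gmax_le.
Proof. by move=> [a|] [b|] //= /le_anti ->. Qed.

Lemma gmax_le_trans : transitive gmax_le.
Proof. by move=> [a|] [b|] [c|] //=; exact: le_trans. Qed.

Lemma gmax_le_total : total gmax_le.
Proof. by move=> [a|] [b|] //=; exact: oag_le_total. Qed.

HB.instance Definition _ := Order.Le_isPOrder.Build ring_display (gmax G)
  gmax_le_refl gmax_le_anti gmax_le_trans.

HB.instance Definition _ := Order.POrder_isTotal.Build ring_display (gmax G)
  gmax_le_total.

Lemma gmax_max0l : left_id (None : gmax G) Order.max.
Proof. by move=> x; apply/max_idPr. Qed.

HB.instance Definition _ := GRing.isNmodule.Build (gmax G)
  (@maxA _ (gmax G)) (@maxC _ (gmax G)) gmax_max0l.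

Lemma gmax_mulA : associative gmax_mul.
Proof. by move=> [a|] [b|] [c|] //=; rewrite addrA. Qed.

Lemma gmax_mulC : commutative gmax_mul.
Proof. by move=> [a|] [b|] //=; rewrite addrC. Qed.

Lemma gmax_mul1l : left_id (Some 0 : gmax G) gmax_mul.
Proof. by move=> [a|] //=; rewrite add0r. Qed.

Lemma gmax_mul_mono z x y : x <= y -> gmax_mul z x <= gmax_mul z y.
Proof. by case: z x y => [c|] [a|] [b|] // ab; exact: oag_leD2l. Qed.

Lemma gmax_mulDl : left_distributive gmax_mul Order.max.
Proof.
move=> x y z; rewrite !(gmax_mulC _ z).
by case: (leP x y) => [|/ltW] /(gmax_mul_mono z) h; apply/esym;
  [apply/max_idPr|apply/max_idPl].
Qed.

Lemma gmax_mul0l : left_zero (None : gmax G) gmax_mul.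
Proof. by []. Qed.

HB.instance Definition _ := GRing.Nmodule_isComNzSemiRing.Build (gmax G)
  gmax_mulA gmax_mulC gmax_mul1l gmax_mulDl gmax_mul0l (erefl true).

End GmaxTheory.

(* A semiring morphism A -> Gamma_max is exactly a map preserving 0, 1, * and
   sending + to max. *)
Record valuation (A : idemSemiRingType) := Valuation {
  val_group : oagType;
  val_fun :> {rmorphism A -> gmax val_group}
}.

Section ValuationImage.
Variables (A : idemSemiRingType) (nu : valuation A).

Definition val_range : pred (gmax (val_group nu)) := mem (range nu).

Lemma val_range_closed : GRing.semiring_closed val_range.
Proof.
have rP z : reflect (range nu z) (z \in val_range).
  by apply: (iffP idP) => [/set_mem|/mem_set].
split; split.
- by apply/rP; exists 0; rewrite ?rmorph0.
- by move=> _ _ /rP[a _ <-] /rP[b _ <-]; apply/rP; exists (a + b); rewrite ?rmorphD.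
- by apply/rP; exists 1; rewrite ?rmorph1.
- by move=> _ _ /rP[a _ <-] /rP[b _ <-]; apply/rP; exists (a * b); rewrite ?rmorphM.
Qed.

Definition val_image : Type := {z | val_range z}.

HB.instance Definition _ := SubChoice.on val_image.
HB.instance Definition _ := GRing.SubChoice_isSubComPzSemiRing.Build _ _ val_image val_range_closed.

Definition to_val_image (a : A) : val_image :=
  exist _ (nu a) (mem_set (imageT nu a)).

End ValuationImage.

Definition val_equiv (A : idemSemiRingType) (nu1 nu2 : valuation A) : Prop :=
  exists f : {rmorphism val_image nu1 -> val_image nu2},
    bijective f /\ forall a, f (to_val_image nu1 a) = to_val_image nu2 a.

Definition val_class (A : idemSemiRingType) (nu : valuation A)
  : set (valuation A) := [set mu | val_equiv nu mu].

Definition Spv (A : idemSemiRingType) : Type :=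
  set_type (range (@val_class A)).

Definition spv_class (A : idemSemiRingType) (nu : valuation A) : Spv A :=
  exist _ (val_class nu) (mem_set (imageT (@val_class A) nu)).

HB.instance Definition _ (A : idemSemiRingType) := gen_eqMixin (valuation A).
HB.instance Definition _ (A : idemSemiRingType) := gen_choiceMixin (valuation A).
HB.instance Definition _ (A : idemSemiRingType) := Choice.on (Spv A).

Section SpvTopology.
Variable A : idemSemiRingType.

Definition Spv_basic (xy : A * A) : set (Spv A) :=
  [set spv_class nu | nu in
     [set nu : valuation A | nu xy.1 <= nu xy.2 /\ nu xy.2 != 0]].

Lemma gmaxD_max (G : oagType) (x y : gmax G) : x + y = Order.max x y.
Proof. by []. Qed.

Lemma gmaxD_idPr (G : oagType) (x y : gmax G) : (x <= y) = (x + y == y).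
Proof. by rewrite gmaxD_max; apply/max_idPr/eqP. Qed.

Lemma gmax_mul_eq0 (G : oagType) (x y : gmax G) :
  (x * y == 0) = (x == 0) || (y == 0).
Proof. by case: x y => [a|] [b|]. Qed.

Lemma gmax_ler_pM2r (G : oagType) (z x y : gmax G) :
  z != 0 -> (x * z <= y * z) = (x <= y).
Proof.
case: z => [c|] // _; apply/idP/idP => h; last first.
  by rewrite !(mulrC _ (Some c : gmax G)); exact: gmax_mul_mono.
have /(gmax_mul_mono (Some (- c))) := h.
have K (u : gmax G) : gmax_mul (Some (- c)) (u * (Some c : gmax G)) = u.
  by case: u => [u|] //; congr Some; rewrite addrC addrK.
by rewrite !K.
Qed.

Lemma val_equiv_refl (nu : valuation A) : val_equiv nu nu.
Proof. by exists idfun; split=> //; exact: (inv_bij (fun=> erefl)). Qed.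

Lemma val_equiv_ker (nu mu : valuation A) : val_equiv nu mu ->
  forall a b, (nu a == nu b) = (mu a == mu b).
Proof.
move=> [f [/bij_inj fI fE]] a b.
have E (la : valuation A) : (la a == la b) = (to_val_image la a == to_val_image la b).
  by [].
by rewrite !E -!fE (inj_eq fI).
Qed.

Lemma spv_class_ker (nu mu : valuation A) : spv_class nu = spv_class mu ->
  forall a b, (nu a == nu b) = (mu a == mu b).
Proof.
move=> /(congr1 val) /= E a b; apply/esym/val_equiv_ker.
by have := val_equiv_refl nu; rewrite -[val_equiv _ _]/(val_class nu nu) E.
Qed.

Lemma Spv_basicE (nu : valuation A) x y :
  Spv_basic (x, y) (spv_class nu) <-> nu x <= nu y /\ nu y != 0.
Proof.
split=> [[mu /= [h1 h2] /spv_class_ker E]|?]; last by exists nu.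
move: h1 h2; rewrite !gmaxD_idPr -!rmorphD -(rmorph0 mu) -(rmorph0 nu).
by rewrite !E.
Qed.

Lemma spv_classP (p : Spv A) : exists nu, p = spv_class nu.
Proof.
case: p => c cP; have /set_mem [nu _ E] := cP.
by exists nu; apply: val_inj.
Qed.

Lemma Spv_basic_cover : \bigcup_(xy in [set: A * A]) Spv_basic xy = setT.
Proof.
apply/seteqP; split=> // p _; have [nu ->] := spv_classP p.
by exists (1, 1) => //; apply/Spv_basicE; rewrite rmorph1.
Qed.

Lemma Spv_basic_join (i j : A * A) (t : Spv A) :
  [set: A * A] i -> [set: A * A] j -> Spv_basic i t -> Spv_basic j t ->
  exists k, [/\ [set: A * A] k, Spv_basic k t &
                Spv_basic k `<=` Spv_basic i `&` Spv_basic j].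
Proof.
have H (nu : valuation A) x y z w :
    (nu (x * w + z * y) <= nu (y * w)) /\ nu (y * w) != 0 <->
    (nu x <= nu y /\ nu y != 0) /\ (nu z <= nu w /\ nu w != 0).
  rewrite rmorphD gmaxD_max ge_max !rmorphM gmax_mul_eq0 negb_or.
  split=> [[/andP[h1 h2] /andP[y0 w0]]|[[h1 y0] [h2 w0]]].
    by move: h1 h2; rewrite gmax_ler_pM2r // [nu y * _]mulrC gmax_ler_pM2r.
  by rewrite gmax_ler_pM2r // [nu y * _]mulrC gmax_ler_pM2r // h1 h2 y0 w0.
case: i j => [x y] [z w] _ _; have [nu ->] := spv_classP t.
move=> /Spv_basicE h1 /Spv_basicE h2.
exists (x * w + z * y, y * w); split=> //; first by apply/Spv_basicE/H.
move=> p; have [mu ->] := spv_classP p => /Spv_basicE/H[? ?].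
by split; apply/Spv_basicE.
Qed.

(* isBaseTopological wants a pointed index type. *)
Definition Spv_index : Type := A * A.
HB.instance Definition _ := Choice.on Spv_index.
HB.instance Definition _ := isPointed.Build Spv_index (0, 0).

HB.instance Definition _ :=
  isBaseTopological.Build (Spv A) (I := Spv_index) Spv_basic_cover Spv_basic_join.

End SpvTopology.

(* The power set of T with the hull-kernel topology. *)
Definition hull_kernel (T : Type) : Type := set T.

HB.instance Definition _ (T : Type) := Choice.on (hull_kernel T).
HB.instance Definition _ (T : Type) :=
  isSubBaseTopological.Build (hull_kernel T) [set F : set T | finite_set F]
    (fun F => [set I : hull_kernel T | ~ (F `<=` I)]).

Section PrimeCongruences.
Variable A : idemSemiRingType.

Definition congruence (C : set (A * A)) : Prop :=
  RelationClasses.Equivalence (fun a b => C (a, b)) /\ GRing.semiring_closed (mem C).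

Definition twisted_mul (x y : A * A) : A * A :=
  (x.1 * y.1 + x.2 * y.2, x.1 * y.2 + x.2 * y.1).

Definition prime_congruence (C : set (A * A)) : Prop :=
  [/\ congruence C, C <> setT &
      forall x y, C (twisted_mul x y) -> C x \/ C y].

Definition SpecC : Type :=
  set_type [set C : hull_kernel (A * A) | prime_congruence C].

HB.instance Definition _ := Topological.copy SpecC
  (set_type [set C : hull_kernel (A * A) | prime_congruence C]).

End PrimeCongruences.

Definition irreducible_set (X : topologicalType) (Z : set X) : Prop :=
  Z !=set0 /\
  forall Z1 Z2, closed Z1 -> closed Z2 -> Z `<=` Z1 `|` Z2 ->
    Z `<=` Z1 \/ Z `<=` Z2.

Definition qc_open (X : topologicalType) : set (set X) :=
  [set U | open U /\ compact U].

(* compact is quasi-compactness: it includes no separation axiom. *)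
Definition spectral_space (X : topologicalType) : Prop :=
  [/\ compact [set: X],
      kolmogorov_space X,
      forall F : set (set X), finite_set F -> F `<=` @qc_open X ->
        qc_open (\bigcap_(U in F) U),
      basis (@qc_open X) &
      forall Z : set X, closed Z -> irreducible_set Z ->
        exists! x : X, closure [set x] = Z].

(* Main.v *)
(* For a prime congruence C on A, the twisted product of (a + b, b) and
   (a + b, a) lies on the diagonal, so A / C is totally ordered; the twisted
   product of (a, b) and (c, 0) is (ac, bc), so A / C is cancellative. Hence
   A / C embeds in Gamma_max, where Gamma is its ordered group of fractions, and C
   is the kernel of the resulting valuation. Conversely kernels of valuations are
   prime, and a valuation is determined up to equivalence by its kernel.
   Spectrality follows from the ultrafilter criterion: for an ultrafilter U on a
   family of prime congruences, the pairs that belong to U-almost all of them form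
   a prime congruence, which is the limit of U in the patch topology. *)
Require Import Defs.
From HB Require Import structures.
From mathcomp Require Import all_boot all_order all_algebra.
From mathcomp Require Import finmap.
From mathcomp Require Import all_classical all_reals all_analysis.

Set Implicit Arguments.
Unset Strict Implicit.
Unset Printing Implicit Defensive.

Import Order.TTheory GRing.Theory.

Local Open Scope classical_set_scope.
Local Open Scope ring_scope.

(** * Ultrafilters and spectral spaces *)

Lemma ultra_setC (T : Type) (U : set_system T) (B : set T) :
  UltraFilter U -> U (~` B) <-> ~ U B.
Proof.
move=> UU; split=> [UnB UB|nUB]; last by have [] := in_ultra_setVsetC B UU.
have : U (B `&` ~` B) by exact: filterI.
by rewrite setICr => /filter_not_empty.
Qed.

Lemma ultra_setU (T : Type) (U : set_system T) (B C : set T) :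
  UltraFilter U -> U (B `|` C) -> U B \/ U C.
Proof.
move=> UU UBC; case: (in_ultra_setVsetC B UU) => [|UnB]; [by left|right].
by apply: filterS (filterI UBC UnB) => x [[]].
Qed.

(** The form of T0 that the two spectra meet directly: a point can be recovered from the open sets
    that contain it. *)
Lemma kolmogorov_open_inj (X : topologicalType) :
  (forall x y : X, (forall V, open V -> (V x <-> V y)) -> x = y) ->
  kolmogorov_space X.
Proof.
move=> inj x y /eqP xy; apply: contrapT => nsep; apply: xy; apply: inj => V oV.
by split=> h; apply: contrapT => nh; apply: nsep; exists V; rewrite !inE; [left|right];
  split=> //; exact: open_nbhs_nbhs.
Qed.

(* The relation lim is the convergence of ultrafilters in the patch topology:
   the members of F in the last hypothesis are open and patch-clopen. *)
Lemma spectral_ultrafilter (X : topologicalType)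
    (lim : set_system X -> X -> Prop) :
  (forall U, UltraFilter U -> exists x, lim U x) ->
  kolmogorov_space X ->
  (forall V x, open V -> V x -> exists F : set (set X),
     [/\ finite_set F, \bigcap_(B in F) B `<=` V & forall B, F B ->
       [/\ open B, B x &
         forall U y, UltraFilter U -> lim U y -> (B y <-> U B)]]) ->
  spectral_space X.
Proof.
move=> limP T0 subbaseP.
(* [clop] singles out the patch-clopen sets: whether a limit of an ultrafilter lies in B is decided
   by whether B is in the ultrafilter. *)
pose clop B := forall U y, UltraFilter U -> lim U y -> (B y <-> U B).
have clopT : clop setT by move=> U y UU _; split=> // _; exact: filterT.
have clopI B D : clop B -> clop D -> clop (B `&` D).
  move=> cB cD U y UU Uy; split=> [[/(cB U y UU Uy) UB /(cD U y UU Uy) UD]|UBD].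
    exact: filterI.
  by split; [apply/(cB U y UU Uy)|apply/(cD U y UU Uy)]; apply: filterS UBD => z [].
have clop_finI F : finite_set F -> F `<=` [set B | open B /\ clop B] ->
    open (\bigcap_(B in F) B) /\ clop (\bigcap_(B in F) B).
  move=> /finite_seqP[s ->].
  elim: s => [_|W s IH sub].
    by rewrite set_nil bigcap_set0; split; [exact: openT|exact: clopT].
  have -> : [set` W :: s] = W |` [set` s].
    apply/seteqP; split=> Y /=; rewrite inE; last by case=> ->; rewrite ?eqxx ?orbT.
    by case/orP=> [/eqP|]; [left|right].
  rewrite bigcap_setU1.
  have [oW cW] : open W /\ clop W by apply: sub; rewrite /= mem_head.
  have [os cs] := IH (fun Y sY => sub Y (mem_behead (s := W :: s) sY)).
  by split; [exact: openI|exact: clopI].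
have baseP V x : open V -> V x ->
    exists B, [/\ open B, B x, B `<=` V & clop B].
  move=> oV Vx; have [F [finF FV FP]] := subbaseP V x oV Vx.
  have [|oF cF] := clop_finI F finF; first by move=> B /FP[].
  by exists (\bigcap_(B in F) B); split=> // B /FP[].
have lim_cvg U x : UltraFilter U -> lim U x -> U --> x.
  move=> UU Ux W; rewrite /= nbhsE => -[V [oV Vx] VW].
  have [B [oB Bx BV BU]] := baseP _ _ oV Vx.
  by apply: (filterS VW); apply: (filterS BV); exact/(BU U x).
(* An ultrafilter containing B has a patch limit; [clop] places it in B, and patch convergence
   implies convergence. *)
have clop_compact B : clop B -> compact B.
  rewrite compact_ultra => cB U UU UB; have [x Ux] := limP U UU.
  by exists x; split; [apply/(cB U)|exact: lim_cvg].
have qc_openE : @qc_open X = [set B | open B /\ clop B].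
  apply/seteqP; split=> B [oB]; last by split=> //; exact: clop_compact.
  rewrite compact_ultra => cB; split=> // U x UU Ux; split=> [Bx|UB].
    by apply: (lim_cvg _ _ UU Ux); exact: open_nbhs_nbhs.
  (* The limit y provided by compactness may differ from the patch limit x. A patch-clopen D around
     y inside B belongs to U, hence contains x. *)
  have [y [By Uy]] := cB U UU UB; have [D [oD Dy DB DU]] := baseP _ _ oB By.
  by apply/DB/(DU U x UU Ux)/Uy/open_nbhs_nbhs.
split=> //.
- exact: clop_compact.
- by rewrite qc_openE; exact: clop_finI.
- split=> [B []//|x W]; rewrite nbhsE => -[V [oV Vx] VW].
  have [B [oB Bx BV BU]] := baseP _ _ oV Vx.
  by exists B; [rewrite qc_openE|exact: subset_trans VW].
- move=> Z cZ [[z Zz] irrZ].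
  (* Irreducibility on the open side: open sets meeting Z meet each other inside Z. This makes their
     traces on Z a filter base. *)
  have irrI V1 V2 : open V1 -> open V2 -> Z `&` V1 !=set0 -> Z `&` V2 !=set0 ->
      Z `&` (V1 `&` V2) !=set0.
    move=> oV1 oV2 [x1 [Zx1 V1x]] [x2 [Zx2 V2x]]; apply: contrapT => /nonemptyPn ZV.
    have [||y Zy|/(_ _ Zx1)|/(_ _ Zx2)] // := irrZ (~` V1) (~` V2).
    - exact: open_closedC.
    - exact: open_closedC.
    - rewrite -setCI => Vy; have : (Z `&` (V1 `&` V2)) y by [].
      by rewrite ZV.
  (* A generic point is a patch limit of an ultrafilter containing the traces on
     Z of all the open sets that meet Z. *)
  pose F := filter_from [set V | open V /\ Z `&` V !=set0] (setI Z).
  have FF : ProperFilter F.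
    apply: filter_from_proper => [|V [] //].
    apply: filter_from_filter => [|V1 V2 [oV1 Z1] [oV2 Z2]].
      by exists setT; split; [exact: openT|exists z].
    exists (V1 `&` V2) => [|y [Zy []]//].
    by split; [exact: openI|exact: irrI].
  have [U [UU FU]] := ultraFilterLemma FF; have [x Ux] := limP U UU.
  have FZ V : open V -> Z `&` V !=set0 -> U (Z `&` V).
    by move=> oV ZV; apply: FU; exists V.
  have Zx : Z x.
    apply: cZ => W; rewrite nbhsE => -[V [oV Vx] VW].
    have UV : U V by apply: (lim_cvg _ _ UU Ux); exact: open_nbhs_nbhs.
    have [y [[Zy _] Vy]] : (Z `&` setT) `&` V !=set0.
      by apply: (@filter_ex _ U); apply: filterI UV; apply: FZ; [exact: openT|exists z].
    by exists y; split=> //; exact: VW.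
  have xZ : closure [set x] = Z.
    apply/seteqP; split=> [y xy|y Zy W].
      apply: cZ => W /xy[_ [-> Wx]].
      by exists x.
    rewrite nbhsE => -[V [oV Vy] VW]; exists x; split=> //; apply: VW.
    (* B is open and meets Z at y, so B belongs to U; being patch-clopen, it contains x. Thus x lies
       in every neighbourhood of y. *)
    have [B [oB By BV BU]] := baseP _ _ oV Vy.
    apply/BV/(BU U x UU Ux).
    by apply: filterS (FZ B oB _) => [u []//|]; exists y.
  exists x; split=> // y yZ; apply: contrapT => /eqP/T0[W].
  (* A generic point lies in every neighbourhood of every point of Z, so no neighbourhood can
     separate two generic points. *)
  have closE u : closure [set u] = Z -> Z `<=` [set w | forall V, nbhs w V -> V u].
    by move=> <- w cw V /cw[_ [->]].
  have Zy : Z y by rewrite -yZ; exact: subset_closure.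
  rewrite !inE => -[[xW nWy]|[yW nWx]].
    exact: nWy (closE y yZ x Zx W xW).
  exact: nWx (closE x xZ y Zy W yW).
Qed.

(** Trades the [fset] of indices in [finI_from] for a classical finite set, to read off the basic
    open sets of the hull-kernel topology. *)
Lemma finI_from_finite_set (I : choiceType) (T : Type) (D : set I)
    (f : I -> set T) (E : set T) : finI_from D f E ->
  exists N : set I, [/\ finite_set N, N `<=` D & \bigcap_(i in N) f i = E].
Proof.
move=> [N ND <-]; exists [set` N]; split=> // i /ND.
by rewrite inE.
Qed.

(** * Prime congruences *)

Section Congruences.
Variable A : idemSemiRingType.
Implicit Types C : set (A * A).

Lemma congruenceP C : congruence C <->
  [/\ forall a, C (a, a),
      forall a b, C (a, b) -> C (b, a),
      forall a b c, C (a, b) -> C (b, c) -> C (a, c),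
      forall x y, C x -> C y -> C (x + y) &
      forall x y, C x -> C y -> C (x * y)].
Proof.
have mP z : reflect (C z) (z \in mem C).
  by apply: (iffP idP) => [/set_mem|/mem_set].
split=> [[[r s t] [[_ cD] [_ cM]]]|[r s t cD cM]].
  by split=> // x y /mP Cx /mP Cy; apply/mP; [exact: cD|exact: cM].
split; first by split.
by split; split; try exact/mP/r; move=> x y /mP Cx /mP Cy; apply/mP;
  [exact: cD|exact: cM].
Qed.

(** Multiplying (1, 0) by (c, c) identifies every c with 0. Properness is thus tested on a single
    pair, a condition that passes to ultrafilter limits. *)
Lemma prime_congruence_01 C : prime_congruence C -> ~ C (1, 0).
Proof.
move=> [/congruenceP[r s t cD cM] nT _] C10; apply: nT; apply/seteqP; split=> // -[a b] _.
have C0 c : C (c, 0).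
  by have := cM _ _ (r c) C10; rewrite -[_ * _]/(c * 1, c * 0) mulr1 mulr0.
exact: t (C0 a) (s _ _ (C0 b)).
Qed.

(** The congruence axioms pass to the limit because U is closed under finite intersections and
    supersets, properness through the pair (1, 0), and primality because an ultrafilter containing a
    union contains one of its members. *)
Lemma prime_congruence_ultra (T : Type) (F : T -> set (A * A)) (U : set_system T) :
  UltraFilter U -> (forall t, prime_congruence (F t)) ->
  prime_congruence [set p | U [set t | F t p]].
Proof.
move=> UU Fp.
have cP t : congruence (F t) by have [] := Fp t.
have lift1 p q : (forall t, F t p -> F t q) -> U [set t | F t p] -> U [set t | F t q].
  by move=> h; apply: filterS => t /=; exact: h.
have lift2 p q r : (forall t, F t p -> F t q -> F t r) ->
    U [set t | F t p] -> U [set t | F t q] -> U [set t | F t r].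
  by move=> h Up Uq; apply: filterS (filterI Up Uq) => t [/h]; exact.
split.
- apply/congruenceP; split=> [a|a b|a b c|x y|x y] /=.
  + by apply: filterS filterT => t _; have /congruenceP[r _ _ _ _] := cP t; exact: r.
  + by apply: lift1 => t; have /congruenceP[_ s _ _ _] := cP t; exact: s.
  + by apply: lift2 => t; have /congruenceP[_ _ tr _ _] := cP t; exact: tr.
  + by apply: lift2 => t; have /congruenceP[_ _ _ cD _] := cP t; exact: cD.
  + by apply: lift2 => t; have /congruenceP[_ _ _ _ cM] := cP t; exact: cM.
- move=> /seteqP[_ /(_ (1, 0) I)] /= U10; apply: (@filter_not_empty _ U).
  by apply: filterS U10 => t /=; exact: prime_congruence_01.
- move=> x y /= Uxy; apply: ultra_setU; apply: filterS Uxy => t /=.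
  by have [_ _] := Fp t; exact.
Qed.

End Congruences.

(** * The ordered group of fractions of A / C *)

Section FractionGroup.
Variables (A : idemSemiRingType) (P : SpecC A).
Local Notation C := (set_val P : set (A * A)).
Implicit Types (a b c : A) (p q r : A * A).

Lemma SpecC_prime : prime_congruence C.
Proof. exact: set_valP. Qed.

Let congC : congruence C. Proof. by have [] := SpecC_prime. Qed.
Let C_refl a : C (a, a). Proof. by have /congruenceP[+ _ _ _ _] := congC; exact. Qed.
Let C_sym a b : C (a, b) -> C (b, a).
Proof. by have /congruenceP[_ + _ _ _] := congC; exact. Qed.
Let C_trans b a c : C (a, b) -> C (b, c) -> C (a, c).
Proof. by have /congruenceP[_ _ + _ _] := congC; exact. Qed.
Let C_add p q : C p -> C q -> C (p + q).
Proof. by have /congruenceP[_ _ _ + _] := congC; exact. Qed.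
Let C_mul p q : C p -> C q -> C (p * q).
Proof. by have /congruenceP[_ _ _ _ +] := congC; exact. Qed.
Let C_prime p q : C (twisted_mul p q) -> C p \/ C q.
Proof. by have [_ _] := SpecC_prime; exact. Qed.

(** The canonical order of the idempotent semiring A / C, read on representatives. *)
Definition cong_le a b : Prop := C (a + b, b).

Lemma cong_le_refl a : cong_le a a.
Proof. by rewrite /cong_le add_idem. Qed.

Lemma cong_le_trans b a c : cong_le a b -> cong_le b c -> cong_le a c.
Proof.
move=> ab bc; apply: C_trans (_ : C (a + (b + c), c)).
  exact: C_add (C_refl a) (C_sym bc).
by apply: C_trans bc; rewrite addrA; exact: C_add ab (C_refl c).
Qed.

Lemma cong_le_anti a b : cong_le a b -> cong_le b a -> C (a, b).
Proof. by rewrite /cong_le addrC => ab /C_sym/C_trans; apply; rewrite addrC in ab *. Qed.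

Lemma cong_le_total a b : cong_le a b \/ cong_le b a.
Proof.
suff : C (twisted_mul (a + b, b) (a + b, a)).
  by move=> /C_prime[]; [left|right; rewrite /cong_le addrC].
rewrite /twisted_mul /=.
(* Both coordinates equal a^2 + ab + b^2, since idempotence absorbs repeated terms ab. *)
have -> : (a + b) * (a + b) + b * a = (a + b) * a + b * (a + b).
  rewrite mulrDr -addrA [(a + b) * b]mulrC; congr (_ + _).
  by rewrite mulrDr addrAC add_idem.
exact: C_refl.
Qed.

Lemma cong_le_mul2r c a b : cong_le a b -> cong_le (a * c) (b * c).
Proof. by move=> ab; rewrite /cong_le -mulrDl; exact: C_mul ab (C_refl c). Qed.

Lemma cong_le_mulIr c a b : ~ C (c, 0) -> cong_le (a * c) (b * c) -> cong_le a b.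
Proof.
move=> nc; rewrite /cong_le -mulrDl => abc.
have [] // := @C_prime (a + b, b) (c, 0).
by rewrite /twisted_mul /= !mulr0 addr0 add0r.
Qed.

(** The twisted product of (a, 0) and (b, 0) is (ab, 0), so primality excludes zero divisors in A /
    C. *)
Lemma cong_mul_neq0 a b : ~ C (a, 0) -> ~ C (b, 0) -> ~ C (a * b, 0).
Proof.
move=> na nb ab; have [] // := @C_prime (a, 0) (b, 0).
by rewrite /twisted_mul /= !(mulr0, mul0r) !addr0.
Qed.

(* The pair (a, b) stands for the fraction a / b of nonzero classes in A / C;
   fractions are compared by cross-multiplication. *)
Definition is_frac p : Prop := ~ C (p.1, 0) /\ ~ C (p.2, 0).

Definition frac_le p q : Prop := cong_le (p.1 * q.2) (q.1 * p.2).

Lemma is_frac1 : is_frac 1.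
Proof. by split; exact: prime_congruence_01 SpecC_prime. Qed.

Lemma is_fracM p q : is_frac p -> is_frac q -> is_frac (p * q).
Proof. by move=> [p1 p2] [q1 q2]; split; exact: cong_mul_neq0. Qed.

Lemma frac_le_refl p : frac_le p p.
Proof. exact: cong_le_refl. Qed.

(** Multiply each comparison by the missing denominator, chain them, and cancel q.2, which is
    nonzero in A / C. *)
Lemma frac_le_trans q p r : is_frac q -> frac_le p q -> frac_le q r -> frac_le p r.
Proof.
move=> [_ nq2] /(cong_le_mul2r r.2) pq /(cong_le_mul2r p.2) qr.
apply: (cong_le_mulIr nq2); rewrite mulrAC [r.1 * _ * _]mulrAC.
by apply: cong_le_trans qr; rewrite [q.1 * _ * _]mulrAC.
Qed.

Lemma frac_leM2l r p q : frac_le p q -> frac_le (r * p) (r * q).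
Proof.
rewrite /frac_le /= => /(cong_le_mul2r (r.1 * r.2)).
by rewrite -!(mulrC (r.1 * r.2)) ![r.1 * _ * (r.2 * _)]mulrACA.
Qed.

(** A choice of representative in the class of p, which lets the group of fractions be a subtype of
    A * A instead of a quotient. *)
Definition frac_repr p : A * A :=
  xget 1 [set q | is_frac q /\ frac_le p q /\ frac_le q p].

Lemma frac_reprP p : is_frac p ->
  [/\ is_frac (frac_repr p), frac_le p (frac_repr p) & frac_le (frac_repr p) p].
Proof.
rewrite /frac_repr => fp.
case: xgetP => [q _ [? []]//|/(_ p)[]]; split=> //; split; exact: frac_le_refl.
Qed.

(** Equivalent fractions have the same set of equivalent fractions, and [xget] depends only on that
    set. *)
Lemma frac_repr_eq p q : is_frac p -> is_frac q ->
  frac_le p q -> frac_le q p -> frac_repr p = frac_repr q.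
Proof.
move=> fp fq pq qp; congr (xget 1); apply/seteqP.
by split=> r [fr [le1 le2]]; split=> //; split;
  by [exact: frac_le_trans le1|exact: frac_le_trans le2 _].
Qed.

Definition frac_group : Type :=
  {p : A * A | `[< is_frac p >] && (frac_repr p == p)}.

HB.instance Definition _ := SubChoice.on frac_group.
Implicit Types x y z : frac_group.

Lemma frac_repr_subproof p (q := if `[< is_frac p >] then p else 1) :
  `[< is_frac (frac_repr q) >] && (frac_repr (frac_repr q) == frac_repr q).
Proof.
have fq : is_frac q by rewrite /q; case: asboolP => // _; exact: is_frac1.
have [fr le_qr le_rq] := frac_reprP fq.
by apply/andP; split; [exact/asboolP|exact/eqP/frac_repr_eq].
Qed.

(* Pairs that are not fractions are sent to 1. *)
Definition to_frac p : frac_group := exist _ (frac_repr _) (frac_repr_subproof p).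

Lemma is_frac_val x : is_frac (val x).
Proof. by case: x => p /= /andP[/asboolP]. Qed.

Lemma to_fracK : cancel val to_frac.
Proof.
move=> x; apply: val_inj => /=; case: asboolP => [_|[]]; last exact: is_frac_val.
by case: x => p /= /andP[_ /eqP].
Qed.

Lemma val_to_frac p : is_frac p ->
  frac_le p (val (to_frac p)) /\ frac_le (val (to_frac p)) p.
Proof. by move=> fp /=; case: asboolP => // _; have [] := frac_reprP fp. Qed.

Definition frac_group_le x y : bool := `[< frac_le (val x) (val y) >].

Lemma frac_group_le_refl : reflexive frac_group_le.
Proof. by move=> x; apply/asboolP; exact: frac_le_refl. Qed.

Lemma frac_group_le_anti : antisymmetric frac_group_le.
Proof.
move=> x y /andP[/asboolP xy /asboolP yx]; rewrite -[x]to_fracK -[y]to_fracK.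
apply: val_inj; rewrite /= !asboolT; [|exact: is_frac_val..].
by apply: frac_repr_eq xy yx; exact: is_frac_val.
Qed.

Lemma frac_group_le_trans : transitive frac_group_le.
Proof.
move=> y x z /asboolP xy /asboolP yz; apply/asboolP.
exact: frac_le_trans (is_frac_val y) xy yz.
Qed.

Lemma frac_group_le_total : total frac_group_le.
Proof.
move=> x y; apply/orP.
by case: (cong_le_total ((val x).1 * (val y).2) ((val y).1 * (val x).2)) => le_xy;
  [left|right]; exact/asboolP.
Qed.

HB.instance Definition _ := Order.Le_isPOrder.Build ring_display frac_group
  frac_group_le_refl frac_group_le_anti frac_group_le_trans.

Lemma le_to_frac p q : is_frac p -> is_frac q ->
  (to_frac p <= to_frac q) = `[< frac_le p q >].
Proof.
move=> fp fq; have [p1 p2] := val_to_frac fp; have [q1 q2] := val_to_frac fq.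
have fp' := is_frac_val (to_frac p); have fq' := is_frac_val (to_frac q).
apply/asbool_equiv_eq; split=> le_pq.
  exact: frac_le_trans fp' p1 (frac_le_trans fq' le_pq q2).
exact: frac_le_trans fp p2 (frac_le_trans fq le_pq q1).
Qed.

Lemma eq_to_frac p q : is_frac p -> is_frac q ->
  frac_le p q -> frac_le q p -> to_frac p = to_frac q.
Proof.
by move=> fp fq pq qp; apply: le_anti; rewrite !le_to_frac // !asboolT.
Qed.

Definition frac_group_add x y := to_frac (val x * val y).
Definition frac_group_opp x := to_frac ((val x).2, (val x).1).

Lemma frac_leM2 p q p' q' : is_frac q -> is_frac p' ->
  frac_le p p' -> frac_le q q' -> frac_le (p * q) (p' * q').
Proof.
move=> fq fp' pp qq; apply: frac_le_trans (is_fracM fp' fq) _ (frac_leM2l p' qq).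
by rewrite mulrC [p' * q]mulrC; exact: frac_leM2l.
Qed.

(** Sums in the group may be computed on arbitrary fractions, so associativity and the unit law come
    from the product semiring A * A. *)
Lemma to_fracM p q : is_frac p -> is_frac q ->
  frac_group_add (to_frac p) (to_frac q) = to_frac (p * q).
Proof.
move=> fp fq; have [p1 p2] := val_to_frac fp; have [q1 q2] := val_to_frac fq.
have fp' := is_frac_val (to_frac p); have fq' := is_frac_val (to_frac q).
by apply: eq_to_frac; try exact: is_fracM; exact: frac_leM2.
Qed.

Lemma frac_group_addA : associative frac_group_add.
Proof.
move=> x y z; have [fx fy fz] := And3 (is_frac_val x) (is_frac_val y) (is_frac_val z).
rewrite -[x]to_fracK -[y]to_fracK -[z]to_fracK.
by rewrite !to_fracM ?mulrA //; exact: is_fracM.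
Qed.

Lemma frac_group_addC : commutative frac_group_add.
Proof. by move=> x y; rewrite /frac_group_add mulrC. Qed.

Lemma frac_group_add0 : left_id (to_frac 1) frac_group_add.
Proof.
move=> x; have fx := is_frac_val x; rewrite -[x]to_fracK.
by rewrite to_fracM ?mul1r //; exact: is_frac1.
Qed.

Lemma frac_group_addN : left_inverse (to_frac 1) frac_group_opp frac_group_add.
Proof.
move=> x; have fx := is_frac_val x; have [x1 x2] := fx; rewrite -{2}[x]to_fracK.
rewrite to_fracM //; apply: eq_to_frac; [exact: is_fracM|exact: is_frac1|..];
  by rewrite /frac_le /= !(mulr1, mul1r) mulrC; exact: cong_le_refl.
Qed.

HB.instance Definition _ := GRing.isZmodule.Build frac_group
  frac_group_addA frac_group_addC frac_group_add0 frac_group_addN.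

Lemma frac_group_leD2l z x y : x <= y -> z + x <= z + y.
Proof.
move=> /asboolP le_xy; rewrite -[z + x]/(to_frac _) -[z + y]/(to_frac _).
rewrite le_to_frac; try by apply: is_fracM; exact: is_frac_val.
by apply/asboolP; exact: frac_leM2l.
Qed.

HB.instance Definition _ := isTotallyOrderedZmodule.Build frac_group
  frac_group_le_total frac_group_leD2l.

End FractionGroup.

(** * Valuations and their kernels *)

Section ResidueValuation.
Variables (A : idemSemiRingType) (P : SpecC A).
Local Notation C := (set_val P : set (A * A)).
Implicit Types a b : A.

Lemma cong_leP a b : C (a, b) <-> cong_le P a b /\ cong_le P b a.
Proof.
split=> [ab|[]]; last exact: cong_le_anti.
have [/congruenceP[r s _ cD _] _ _] := SpecC_prime P.
split; rewrite /cong_le.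
  by have := cD _ _ ab (r b); rewrite -[_ + _]/(a + b, b + b) add_idem.
by have := cD _ _ (s _ _ ab) (r a); rewrite -[_ + _]/(b + a, a + a) add_idem.
Qed.

Lemma cong_le0 a : cong_le P a 0 <-> C (a, 0).
Proof. by rewrite /cong_le addr0. Qed.

Lemma cong_ge0 a : cong_le P 0 a.
Proof. by rewrite /cong_le add0r; have [/congruenceP[]] := SpecC_prime P. Qed.

(** The map sending a to the fraction a / 1, with the class of 0 sent to -oo. *)
Definition residue_val a : gmax (frac_group P) :=
  if `[< C (a, 0) >] then None else Some (to_frac P (a, 1)).

Lemma is_frac_div1 a : ~ C (a, 0) -> is_frac P (a, 1).
Proof. by split=> //; exact: prime_congruence_01 (SpecC_prime P). Qed.

(** Comparing a / 1 with b / 1 by cross-multiplication returns the order of A / C. Both the kernel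
    and additivity are deduced from this order embedding. *)
Lemma residue_val_le a b : (residue_val a <= residue_val b) = `[< cong_le P a b >].
Proof.
rewrite /residue_val; case: asboolP => [/cong_le0 a0|na].
  by rewrite (asboolT (cong_le_trans a0 (cong_ge0 b))).
case: asboolP => [/cong_le0 b0|nb].
  by rewrite asboolF // => ab; apply/na/cong_le0/(cong_le_trans ab).
rewrite -[LHS]/(to_frac P (a, 1) <= to_frac P (b, 1)) le_to_frac; try exact: is_frac_div1.
by rewrite /frac_le /= !mulr1.
Qed.

Lemma residue_val_ker a b : residue_val a = residue_val b <-> C (a, b).
Proof.
rewrite cong_leP; split=> [ab|[ab ba]].
  by split; apply/asboolP; rewrite -residue_val_le ab.
by apply: le_anti; rewrite !residue_val_le !asboolT.
Qed.

Lemma residue_val_nmod_morphism : nmod_morphism residue_val.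
Proof.
split=> [|a b]; first by rewrite /residue_val asboolT //; apply/cong_le0; exact: cong_ge0.
(* The order being total, it is enough to treat u below v, where u + v is congruent to v and the
   maximum is the value of v. *)
have addl u v : cong_le P u v -> residue_val (u + v) = residue_val u + residue_val v.
  move=> uv; transitivity (residue_val v); first exact/residue_val_ker.
  by apply/esym/max_idPr; rewrite residue_val_le asboolT.
by have [/addl//|/addl] := cong_le_total P a b; rewrite addrC [RHS]addrC.
Qed.

Lemma residue_val_monoid_morphism : monoid_morphism residue_val.
Proof.
split=> [|a b].
  by rewrite /residue_val asboolF //; exact: prime_congruence_01 (SpecC_prime P).
have [/congruenceP[r s _ _ cM] _ _] := SpecC_prime P.
rewrite /residue_val; case: (asboolP (C (a, 0))) => [a0|na].
  rewrite asboolT //; have := cM _ _ a0 (r b).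
  by rewrite -[_ * _]/(a * b, 0 * b) mul0r.
case: (asboolP (C (b, 0))) => [b0|nb].
  rewrite asboolT //; have := cM _ _ b0 (r a).
  by rewrite -[_ * _]/(b * a, 0 * a) mul0r mulrC.
rewrite asboolF; last exact: cong_mul_neq0.
congr Some; rewrite [RHS]to_fracM; try exact: is_frac_div1.
by rewrite -[(a, 1) * (b, 1)]/(a * b, 1 * 1) mulr1.
Qed.

HB.instance Definition _ := GRing.isNmodMorphism.Build A (gmax (frac_group P))
  residue_val residue_val_nmod_morphism.
HB.instance Definition _ := GRing.isMonoidMorphism.Build A (gmax (frac_group P))
  residue_val residue_val_monoid_morphism.

Definition residue_valuation : valuation A :=
  Valuation (residue_val : {rmorphism A -> gmax (frac_group P)}).

End ResidueValuation.

Section ValuationKernel.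
Variable A : idemSemiRingType.
Implicit Types nu mu : valuation A.

Lemma to_val_image_surj nu (z : val_image nu) : exists a, to_val_image nu a = z.
Proof.
by case: z => v vP; have [a _ E] := set_mem vP; exists a; apply: val_inj.
Qed.

(** The map nu a |-> mu a, computed on a preimage chosen by [cid]; the choice is harmless once the
    kernel of [nu] is contained in that of [mu]. *)
Definition val_image_map nu mu (z : val_image nu) : val_image mu :=
  to_val_image mu (projT1 (cid (to_val_image_surj z))).

Lemma val_image_mapE nu mu : (forall a b, nu a = nu b -> mu a = mu b) ->
  forall a, val_image_map mu (to_val_image nu a) = to_val_image mu a.
Proof.
move=> h a; rewrite /val_image_map; case: cid => b /= /(congr1 val) /= /h E.
exact: val_inj.
Qed.

(** Equal kernels make nu a |-> mu a and its reverse well defined; they are mutually inverse, and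
    they are morphisms because [nu] and [mu] are. *)
Lemma val_equivP nu mu :
  val_equiv nu mu <-> forall a b, nu a = nu b <-> mu a = mu b.
Proof.
split=> [/val_equiv_ker E a b|ker].
  by split=> /eqP; [rewrite E|rewrite -E] => /eqP.
have mapE := val_image_mapE (fun a b => (ker a b).1).
have mapK := val_image_mapE (fun a b => (ker a b).2).
have mapD : nmod_morphism (@val_image_map nu mu).
  split=> [|x y].
    have -> : 0 = to_val_image nu 0 by apply: val_inj; rewrite /= rmorph0.
    by rewrite mapE; apply: val_inj; rewrite /= rmorph0.
  have [a <-] := to_val_image_surj x; have [b <-] := to_val_image_surj y.
  have -> : to_val_image nu a + to_val_image nu b = to_val_image nu (a + b).
    by apply: val_inj; rewrite /= rmorphD.
  by rewrite !mapE; apply: val_inj; rewrite /= rmorphD.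
have mapM : monoid_morphism (@val_image_map nu mu).
  split=> [|x y].
    have -> : 1 = to_val_image nu 1 by apply: val_inj; rewrite /= rmorph1.
    by rewrite mapE; apply: val_inj; rewrite /= rmorph1.
  have [a <-] := to_val_image_surj x; have [b <-] := to_val_image_surj y.
  have -> : to_val_image nu a * to_val_image nu b = to_val_image nu (a * b).
    by apply: val_inj; rewrite /= rmorphM.
  by rewrite !mapE; apply: val_inj; rewrite /= rmorphM.
pose addf := GRing.isNmodMorphism.Build _ _ _ mapD.
pose mulf := GRing.isMonoidMorphism.Build _ _ _ mapM.
pose f : {rmorphism val_image nu -> val_image mu} :=
  HB.pack (@val_image_map nu mu) addf mulf.
exists f; split; last exact: mapE.
exists (@val_image_map mu nu) => x; have [a <-] := to_val_image_surj x.
  by rewrite [f _]mapE mapK.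
by rewrite mapK [LHS]mapE.
Qed.

Lemma spv_class_eq nu mu :
  spv_class nu = spv_class mu <-> forall a b, nu a = nu b <-> mu a = mu b.
Proof.
split=> [E a b|ker].
  by split=> /eqP; [rewrite (spv_class_ker E)|rewrite -(spv_class_ker E)] => /eqP.
apply: val_inj; apply/seteqP; split=> la /val_equivP h; apply/val_equivP => a b.
  by rewrite -ker.
by rewrite ker.
Qed.

End ValuationKernel.

(** * The kernel bijection and the spectrality of both spaces *)

Section ValuationSpectrum.
Variable A : idemSemiRingType.
Implicit Types (nu mu : valuation A) (p q : Spv A) (C D : SpecC A).

(** If x1 < x2 and y1 < y2, then x2 * y2 strictly exceeds both x1 * y2 and x2 * y1, so the two
    maxima differ. Exchanging x1 with x2, or y1 with y2, only swaps the two sides. *)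
Lemma gmax_twisted (G : oagType) (x1 x2 y1 y2 : gmax G) :
  x1 * y1 + x2 * y2 = x1 * y2 + x2 * y1 -> x1 = x2 \/ y1 = y2.
Proof.
wlog lex : x1 x2 / x1 <= x2.
  move=> wlg E; have [/wlg|/wlg h] := orP (le_total x1 x2); first exact.
  by have [|->|] := h; [rewrite addrC -E addrC|left|right].
wlog ley : y1 y2 / y1 <= y2.
  move=> wlg E; have [/wlg|/wlg h] := orP (le_total y1 y2); first exact.
  by have [|?|->] := h; [rewrite E|left|right].
have [->|nx] := eqVneq x1 x2; first by left.
have [->|ny] := eqVneq y1 y2; first by right.
(* Something lies strictly below x2, so x2 is not -oo and multiplication by it is strictly
   monotone. *)
have x20 : x2 != 0.
  apply: contraNneq nx => x20; rewrite x20 in lex *.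
  by rewrite eq_le lex; case: (x1).
have y20 : y2 != 0.
  apply: contraNneq ny => y20; rewrite y20 in ley *.
  by rewrite eq_le ley; case: (y1).
have lt1 : x1 * y2 < x2 * y2 by rewrite ltNge gmax_ler_pM2r // -ltNge lt_neqAle nx.
have lt2 : x2 * y1 < x2 * y2.
  by rewrite ltNge !(mulrC x2) gmax_ler_pM2r // -ltNge lt_neqAle ny.
move=> E; have := leNgt (x2 * y2) (x1 * y2 + x2 * y1).
by rewrite -{1}E !gmaxD_max le_max lexx orbT gt_max lt1 lt2.
Qed.

Definition val_ker nu : set (A * A) := [set ab | nu ab.1 = nu ab.2].

Lemma val_ker_prime nu : prime_congruence (val_ker nu).
Proof.
split.
- apply/congruenceP; rewrite /val_ker; split=> //= [a b c -> //|x y|x y].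
    by rewrite !rmorphD => -> ->.
  by rewrite !rmorphM => -> ->.
- by move=> /seteqP[_ /(_ (1, 0) I)] /eqP; rewrite /= rmorph1 rmorph0.
- by move=> x y /=; rewrite /val_ker /= !rmorphD !rmorphM; exact: gmax_twisted.
Qed.

(** Quantifying over all representatives avoids choosing one; equivalent valuations have the same
    kernel. *)
Definition spv_ker p : set (A * A) :=
  [set ab | forall nu, p = spv_class nu -> val_ker nu ab].

Lemma spv_ker_class nu : spv_ker (spv_class nu) = val_ker nu.
Proof.
apply/seteqP; split=> -[a b]; first exact.
by move=> ab mu /spv_class_eq E; apply/E.
Qed.

Lemma spv_ker_prime p : prime_congruence (spv_ker p).
Proof. by have [nu ->] := spv_classP p; rewrite spv_ker_class; exact: val_ker_prime. Qed.

Definition to_SpecC (E : set (A * A)) (Ep : prime_congruence E) : SpecC A :=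
  exist _ (E : hull_kernel (A * A)) (mem_set Ep).

Definition spv_to_spec p : SpecC A := to_SpecC (spv_ker_prime p).

Lemma spv_to_spec_class nu : set_val (spv_to_spec (spv_class nu)) = val_ker nu.
Proof. exact: spv_ker_class. Qed.

Lemma spv_to_specK C : spv_to_spec (spv_class (residue_valuation C)) = C.
Proof.
apply: val_inj; rewrite [LHS]spv_to_spec_class; apply/seteqP.
by split=> -[a b] /residue_val_ker.
Qed.

Lemma spv_to_spec_inj : injective spv_to_spec.
Proof.
move=> p q; have [nu ->] := spv_classP p; have [mu ->] := spv_classP q.
move=> /(congr1 (@set_val _ _)); rewrite !spv_to_spec_class => E.
by apply/spv_class_eq => a b; rewrite -[_ = _]/(val_ker nu (a, b)) E.
Qed.

Lemma spv_to_spec_bij : bijective spv_to_spec.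
Proof.
exists (fun C => spv_class (residue_valuation C)); last exact: spv_to_specK.
by move=> p; apply: spv_to_spec_inj; rewrite spv_to_specK.
Qed.

(** Since nu a <= nu b means nu (a + b) = nu b, a basic open set is a Boolean condition on two pairs
    of the congruence, hence patch-clopen. *)
Lemma Spv_basic_ker a b p : Spv_basic (a, b) p <->
  set_val (spv_to_spec p) (a + b, b) /\ ~ set_val (spv_to_spec p) (b, 0).
Proof.
have [nu ->] := spv_classP p; rewrite Spv_basicE spv_to_spec_class /val_ker /=.
rewrite gmaxD_idPr -rmorphD rmorph0.
by split=> -[ab b0]; split; exact/eqP.
Qed.

(** Convergence in the patch topology, where both membership and non-membership of a given pair are
    open conditions. *)
Definition SpecC_patch_lim (U : set_system (SpecC A)) C : Prop :=
  forall ab, set_val C ab <-> U [set D : SpecC A | set_val D ab].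

Lemma open_SpecC_notin ab : open [set C : SpecC A | ~ set_val C ab].
Proof.
pose b (E : set (A * A)) := [set I : hull_kernel (A * A) | ~ (E `<=` I)].
exists (b [set ab]); last first.
  by apply/seteqP; split=> C nC Cab; [apply: nC => _ ->|exact/nC/Cab].
exists [set b [set ab]]; last by rewrite bigcup_set1.
move=> _ ->; apply: finI_from1; exact: finite_set1.
Qed.

Lemma spectral_SpecC : spectral_space (SpecC A).
Proof.
apply: (@spectral_ultrafilter _ SpecC_patch_lim).
- move=> U UU; have Up := prime_congruence_ultra UU (@SpecC_prime A).
  by exists (to_SpecC Up).
- apply: kolmogorov_open_inj => C D CD; apply: val_inj; apply/seteqP.
  by split=> ab h; apply: contrapT; apply/(CD _ (open_SpecC_notin ab)) => /(_ h).
- move=> V C [V' [J JI <-] <-] [E JE]; rewrite -[isBaseTopological.b _]/E => EC.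
  (* A basic open set E of the hull-kernel topology is cut out by a finite family N of finite sets
     F, none contained in C. *)
  have /finI_from_finite_set[N [finN NF NE]] :
      finI_from [set F : set (A * A) | finite_set F]
        (fun F => [set I : hull_kernel (A * A) | ~ (F `<=` I)]) E by exact: JI.
  (* L collects the pairs outside C from all F in N. Each F contains such a pair, so a D that avoids
     L contains no F and therefore lies in E. *)
  pose L := \bigcup_(F in N) (F `&` ~` set_val C).
  exists [set [set D : SpecC A | ~ set_val D ab] | ab in L]; split.
  + apply/finite_image/bigcup_finite => // F /NF finF.
    exact: finite_setIl.
  + move=> D DL; exists E => //; rewrite -[isBaseTopological.b _]/E -NE => F NF'.
    have : ~ (F `<=` set_val C) by move: EC; rewrite -NE; exact.
    move=> FC FD; apply: FC => ab Fab; apply: contrapT => nC.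
    have LD : [set D : SpecC A | ~ set_val D ab] D.
      by apply: DL; exists ab => //; exists F.
    exact/LD/FD.
  + move=> _ [ab [F NF' [Fab nC]] <-]; split=> //; first exact: open_SpecC_notin.
    move=> U D UU UD; rewrite -[X in U X]/(~` [set G : SpecC A | set_val G ab]).
    by rewrite ultra_setC; split=> nD /UD.
Qed.

(** The patch convergence of prime congruences, carried over to [Spv A] by the kernel bijection. *)
Definition Spv_patch_lim (U : set_system (Spv A)) p : Prop :=
  forall ab, set_val (spv_to_spec p) ab <->
    U [set q : Spv A | set_val (spv_to_spec q) ab].

Lemma open_Spv_basic ab : open (Spv_basic ab : set (Spv A)).
Proof. by exists [set ab : Spv_index A]; [|rewrite bigcup_set1]. Qed.

Lemma spectral_Spv : spectral_space (Spv A).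
Proof.
apply: (@spectral_ultrafilter _ Spv_patch_lim).
- move=> U UU.
  have Up := prime_congruence_ultra UU (fun q => SpecC_prime (spv_to_spec q)).
  exists (spv_class (residue_valuation (to_SpecC Up))).
  by move=> ab; rewrite spv_to_specK.
- apply: kolmogorov_open_inj => p q pq.
  have basicE ab : Spv_basic ab p <-> Spv_basic ab q by apply: pq; exact: open_Spv_basic.
  have [nu pE] := spv_classP p; have [mu qE] := spv_classP q.
  rewrite pE qE; apply/spv_class_eq => a b.
  (* The kernel is recovered from the basic open sets: two values agree when they are nonzero and
     comparable both ways, or both zero. The set D(a, a) is the locus where the value of a is
     nonzero. *)
  have eqE (la : valuation A) : la a = la b <->
      (Spv_basic (a, b) (spv_class la) /\ Spv_basic (b, a) (spv_class la)) \/
      (~ Spv_basic (a, a) (spv_class la) /\ ~ Spv_basic (b, b) (spv_class la)).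
    rewrite !Spv_basicE !lexx; split=> [E|[[[ab _] [ba _]]|[na nb]]].
    - rewrite E lexx; have [b0|b0] := eqVneq (la b) 0; [right|left]; last by [].
      by split=> -[].
    - by apply: le_anti; rewrite ab.
    - have eq0 c : ~ (true /\ la c != 0) -> la c = 0.
        by move=> nc; apply/eqP; apply: contrapT => /negP c0; apply: nc.
      by rewrite (eq0 _ na) (eq0 _ nb).
  by rewrite !eqE -pE -qE !basicE.
- move=> V p [I _ <-] [[a b] Iab abp].
  exists [set Spv_basic (a, b)]; split=> //.
  + by rewrite bigcap_set1 => q abq; exists (a, b).
  + move=> _ ->; split=> //; first exact: open_Spv_basic.
    move=> U q UU Uq; rewrite Spv_basic_ker.
    have -> : Spv_basic (a, b) =
        [set q : Spv A | set_val (spv_to_spec q) (a + b, b)] `&`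
        ~` [set q : Spv A | set_val (spv_to_spec q) (b, 0)].
      by apply/seteqP; split=> r /Spv_basic_ker.
    rewrite !Uq -ultra_setC; split=> [[]|UI]; first exact: filterI.
    by split; apply: filterS UI => r [].
Qed.

End ValuationSpectrum.

Theorem theoremC (A : idemSemiRingType) :
  (exists Phi : Spv A -> SpecC A,
     bijective Phi /\
     forall nu : valuation A,
       set_val (Phi (spv_class nu)) = [set ab : A * A | nu ab.1 = nu ab.2]) /\
  spectral_space (Spv A) /\
  spectral_space (SpecC A).
Proof.
split; last by split; [exact: spectral_Spv|exact: spectral_SpecC].
exists (@spv_to_spec A); split; first exact: spv_to_spec_bij.
exact: spv_to_spec_class.
Qed.
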